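(* Let $\mathcal{C}$ be a ribbon Ab-category which is an abelian category and whose ground ring $K=\operatorname{End}_{\mathcal{C}}(\mathbb{1})$ is a field. Let $J$ be an ambidextrous object of $\mathcal{C}$, and let $V$ be an object of $\mathcal{I}_J$ with $\operatorname{End}_{\mathcal{C}}(V)=K$ (that is, $\operatorname{End}_{\mathcal{C}}(V)=K\operatorname{Id}_V\cong K$) and such that $d_V:V^*\otimes V\to\mathbb{1}$ is an epimorphism. Then: (1) Let $U\in\mathcal{I}_V\subseteq\mathcal{I}_J$. If $\mathsf{d}_J(V)=0$, then $\mathsf{d}_J(U)=0$. (2) The canonical epimorphism $d_V\otimes\operatorname{Id}_J:V^*\otimes V\otimes J\to J$ splits if and only if $\mathsf{d}_J(V)\neq 0$. (3) If $J$ is not projective in $\mathcal{C}$ and $P$ is projective in $\mathcal{C}$, then $P$ is an object of $\mathcal{I}_J$ and $\mathsf{d}_J(P)=0$.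
   Context: A ribbon category is a tensor (monoidal) category $\mathcal{C}$ with unit object $\mathbb{1}$, with a braiding $c_{V,W}:V\otimes W\to W\otimes V$, a duality $V\mapsto V^*$ with morphisms $b_V:\mathbb{1}\to V\otimes V^*$, $d_V:V^*\otimes V\to\mathbb{1}$ satisfying the zig-zag identities, and a twist $\theta_V:V\to V$. It is an Ab-category if all Hom sets are additive abelian groups and composition and tensor product of morphisms are bilinear. Hom sets are $K$-modules via $kf=k\otimes f$. Put $b'_V=(\operatorname{Id}_{V^*}\otimes\theta_V)\circ c_{V,V^*}\circ b_V$ and $d'_V=d_V\circ c_{V,V^*}\circ(\theta_V\otimes\operatorname{Id}_{V^*})$. For $f\in\operatorname{End}_{\mathcal{C}}(V\otimes W)$ set $\operatorname{tr}_L(f)=(d_V\otimes\operatorname{Id}_W)(\operatorname{Id}_{V^*}\otimes f)(b'_V\otimes\operatorname{Id}_W)\in\operatorname{End}_{\mathcal{C}}(W)$ and $\operatorname{tr}_R(f)=(\operatorname{Id}_V\otimes d'_W)(f\otimes\operatorname{Id}_{W^*})(\operatorname{Id}_V\otimes b_W)\in\operatorname{End}_{\mathcal{C}}(V)$. For an object $J$, $\mathcal{I}_J$ is the full subcategory of all objects $U$ for which there are an object $W$ and morphisms $\alpha:U\to J\otimes W$, $\beta:J\otimes W\to U$ with $\beta\circ\alpha=\operatorname{Id}_U$. An ambidextrous trace on an object $V$ is a $K$-linear function $\mathsf{t}:\operatorname{End}_{\mathcal{C}}(V)\to K$ with $\mathsf{t}(\operatorname{tr}_L(f))=\mathsf{t}(\operatorname{tr}_R(f))$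 for all $f\in\operatorname{End}_{\mathcal{C}}(V\otimes V)$. An object $J$ is absolutely indecomposable if $\operatorname{End}_{\mathcal{C}}(J)/\operatorname{Rad}(\operatorname{End}_{\mathcal{C}}(J))\cong K$; the canonical linear map (projection) is denoted $\langle\ \rangle:\operatorname{End}_{\mathcal{C}}(J)\to K$. Standing assumption: for absolutely indecomposable $J$ the elements of $\operatorname{Rad}(\operatorname{End}_{\mathcal{C}}(J))$ are nilpotent. $J$ is ambidextrous if it is absolutely indecomposable and $\langle\ \rangle$ is a non-zero ambidextrous trace on $J$. For an ambidextrous object $J$, the modified dimension $\mathsf{d}_J:\operatorname{Ob}(\mathcal{I}_J)\to K$ is $\mathsf{d}_J(V)=\langle\operatorname{tr}_R(\alpha\circ\beta)\rangle$, where $\alpha:V\to J\otimes W$, $\beta:J\otimes W\to V$ are any morphisms (for some object $W$) with $\beta\circ\alpha=\operatorname{Id}_V$; this does not depend on the choices. *)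

(* Defs.v *)
From HB Require Import structures.
From mathcomp Require Import all_boot all_algebra.
From mathcomp Require Import boolp classical_sets.

Set Implicit Arguments.
Unset Strict Implicit.
Unset Printing Implicit Defensive.

Import GRing.Theory.
Local Open Scope ring_scope.

(* Hom sets are zmodTypes; the choice structure this carries is no restriction
   classically. *)
Record abCat := AbCat {
  ob :> Type;
  hom : ob -> ob -> zmodType;
  idm : forall X : ob, hom X X;
  comp : forall X Y Z : ob, hom Y Z -> hom X Y -> hom X Z;
  compA : forall X Y Z T (h : hom Z T) (g : hom Y Z) (f : hom X Y),
    comp h (comp g f) = comp (comp h g) f;
  comp1m : forall X Y (f : hom X Y), comp (idm Y) f = f;
  compm1 : forall X Y (f : hom X Y), comp f (idm X) = f;
  compDl : forall X Y Z (g1 g2 : hom Y Z) (f : hom X Y),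
    comp (g1 + g2) f = comp g1 f + comp g2 f;
  compDr : forall X Y Z (g : hom Y Z) (f1 f2 : hom X Y),
    comp g (f1 + f2) = comp g f1 + comp g f2
}.

Notation "g ∘ f" := (comp g f) (at level 45, left associativity).
Notation "'Id' X" := (idm X) (at level 10, X at level 9).

Section AbCat.
Variable C : abCat.
Implicit Types X Y Z : C.

Definition is_mono X Y (f : hom X Y) : Prop :=
  forall Z (g h : hom Z X), f ∘ g = f ∘ h -> g = h.

Definition is_epi X Y (f : hom X Y) : Prop :=
  forall Z (g h : hom Y Z), g ∘ f = h ∘ f -> g = h.

Definition splits X Y (e : hom X Y) : Prop :=
  exists s : hom Y X, e ∘ s = Id Y.

Definition projective (P : C) : Prop :=
  forall X Y (e : hom X Y) (f : hom P Y), is_epi e ->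
    exists g : hom P X, e ∘ g = f.

Definition is_kernel X Y (f : hom X Y) (A : C) (k : hom A X) : Prop :=
  f ∘ k = 0 /\
  forall Z (g : hom Z X), f ∘ g = 0 -> exists! h : hom Z A, k ∘ h = g.

Definition is_cokernel X Y (f : hom X Y) (A : C) (q : hom Y A) : Prop :=
  q ∘ f = 0 /\
  forall Z (g : hom Y Z), g ∘ f = 0 -> exists! h : hom A Z, h ∘ q = g.

Definition has_zero_object : Prop :=
  exists O : C, forall X,
    (forall f : hom X O, f = 0) /\ (forall f : hom O X, f = 0).

Definition has_biproducts : Prop :=
  forall X Y, exists (S : C) (iX : hom X S) (iY : hom Y S)
                     (pX : hom S X) (pY : hom S Y),
    [/\ pX ∘ iX = Id X, pY ∘ iY = Id Y, pX ∘ iY = 0, pY ∘ iX = 0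
      & iX ∘ pX + iY ∘ pY = Id S].

Definition abelian_category : Prop :=
  [/\ has_zero_object,
      has_biproducts,
      forall X Y (f : hom X Y),
        (exists (A : C) (k : hom A X), is_kernel f k) /\
        (exists (A : C) (q : hom Y A), is_cokernel f q),
      forall X Y (f : hom X Y), is_mono f ->
        exists (Z : C) (g : hom Y Z), is_kernel g f
    & forall X Y (f : hom X Y), is_epi f ->
        exists (Z : C) (g : hom Z X), is_cokernel g f].

End AbCat.

Definition endo (C : abCat) (X : C) : Type := hom X X.

HB.instance Definition _ (C : abCat) (X : C) :=
  GRing.Zmodule.copy (endo X) (hom X X).
HB.instance Definition _ (C : abCat) (X : C) :=
  GRing.Zmodule_isPzRing.Build (endo X)
    (@compA C X X X X) (@comp1m C X X) (@compm1 C X X)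
    (@compDl C X X X) (@compDr C X X X).

Section Rings.
Variable R : pzRingType.

Definition is_field : Prop :=
  [/\ (1 : R) <> 0, commutative (@GRing.mul R)
    & forall x : R, x <> 0 -> exists y : R, y * x = 1 /\ x * y = 1].

Definition left_ideal (I : set R) : Prop :=
  [/\ I 0, forall x y, I x -> I y -> I (x + y) & forall a x, I x -> I (a * x)].

Definition maximal_left_ideal (I : set R) : Prop :=
  [/\ left_ideal I, I <> setT
    & forall I', left_ideal I' -> (I `<=` I')%classic -> I' = I \/ I' = setT].

(* The Jacobson radical. *)
Definition Rad : set R :=
  fun x => forall I : set R, maximal_left_ideal I -> I x.

End Rings.
Arguments Rad : clear implicits.

(* Monoidal Ab-categories, not assumed strict. *)
Record tensorAbCat := TensorAbCat {
  tens_base :> abCat;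
  unit_ob : tens_base;
  tens : tens_base -> tens_base -> tens_base;
  tensm : forall X Y X' Y' : tens_base,
    hom X X' -> hom Y Y' -> hom (tens X Y) (tens X' Y');
  tensm1 : forall X Y : tens_base, tensm (Id X) (Id Y) = Id (tens X Y);
  tensmM : forall (X Y Z X' Y' Z' : tens_base)
      (g : hom Y Z) (f : hom X Y) (g' : hom Y' Z') (f' : hom X' Y'),
    tensm (g ∘ f) (g' ∘ f') = tensm g g' ∘ tensm f f';
  tensmDl : forall (X Y X' Y' : tens_base) (f1 f2 : hom X X') (g : hom Y Y'),
    tensm (f1 + f2) g = tensm f1 g + tensm f2 g;
  tensmDr : forall (X Y X' Y' : tens_base) (f : hom X X') (g1 g2 : hom Y Y'),
    tensm f (g1 + g2) = tensm f g1 + tensm f g2;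

  assoc : forall X Y Z : tens_base,
    hom (tens (tens X Y) Z) (tens X (tens Y Z));
  assocV : forall X Y Z : tens_base,
    hom (tens X (tens Y Z)) (tens (tens X Y) Z);
  assocK : forall X Y Z : tens_base,
    assocV X Y Z ∘ assoc X Y Z = Id (tens (tens X Y) Z);
  assocVK : forall X Y Z : tens_base,
    assoc X Y Z ∘ assocV X Y Z = Id (tens X (tens Y Z));
  assoc_nat : forall (X Y Z X' Y' Z' : tens_base)
      (f : hom X X') (g : hom Y Y') (h : hom Z Z'),
    assoc X' Y' Z' ∘ tensm (tensm f g) h
    = tensm f (tensm g h) ∘ assoc X Y Z;

  lunit : forall X : tens_base, hom (tens unit_ob X) X;
  lunitV : forall X : tens_base, hom X (tens unit_ob X);
  lunitK : forall X : tens_base, lunitV X ∘ lunit X = Id (tens unit_ob X);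
  lunitVK : forall X : tens_base, lunit X ∘ lunitV X = Id X;
  lunit_nat : forall (X Y : tens_base) (f : hom X Y),
    lunit Y ∘ tensm (Id unit_ob) f = f ∘ lunit X;

  runit : forall X : tens_base, hom (tens X unit_ob) X;
  runitV : forall X : tens_base, hom X (tens X unit_ob);
  runitK : forall X : tens_base, runitV X ∘ runit X = Id (tens X unit_ob);
  runitVK : forall X : tens_base, runit X ∘ runitV X = Id X;
  runit_nat : forall (X Y : tens_base) (f : hom X Y),
    runit Y ∘ tensm f (Id unit_ob) = f ∘ runit X;

  pentagon : forall W X Y Z : tens_base,
    assoc W X (tens Y Z) ∘ assoc (tens W X) Y Z
    = tensm (Id W) (assoc X Y Z) ∘ assoc W (tens X Y) Z
      ∘ tensm (assoc W X Y) (Id Z);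
  triangle : forall X Y : tens_base,
    tensm (Id X) (lunit Y) ∘ assoc X unit_ob Y = tensm (runit X) (Id Y)
}.

Notation "𝟙" := (unit_ob _).
Notation "X ⊗ Y" := (tens X Y) (at level 40, left associativity).
Notation "f ⊗ᵐ g" := (tensm f g) (at level 40, left associativity).
Notation α := assoc.
Notation "'α⁻¹'" := assocV.
Notation λ := lunit.
Notation "'λ⁻¹'" := lunitV.
Notation ρ := runit.
Notation "'ρ⁻¹'" := runitV.

(* The ground ring; its product is composition. *)
Notation ground C := (endo (unit_ob C)).

Section KModule.
Variable C : tensorAbCat.

(* k f = k ⊗ f, along the identification of 𝟙 ⊗ X with X. *)
Definition scalem (X Y : C) (k : ground C) (f : hom X Y) : hom X Y :=
  λ Y ∘ ((k : hom _ _) ⊗ᵐ f) ∘ λ⁻¹ X.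

Lemma scalemE (X Y : C) (k : ground C) (f : hom X Y) :
  scalem k f = scalem k (Id Y) ∘ f.
Proof.
have lunitV_nat : λ⁻¹ Y ∘ f = (Id 𝟙 ⊗ᵐ f) ∘ λ⁻¹ X.
  rewrite -[RHS]comp1m -lunitK -compA; congr (_ ∘ _).
  by rewrite compA lunit_nat -compA lunitVK compm1.
rewrite /scalem -[RHS]compA lunitV_nat -!compA; congr (_ ∘ _).
by rewrite compA -tensmM compm1 comp1m.
Qed.

Lemma scalemA (X : C) (a b : ground C) (f : endo X) :
  scalem a (scalem b f) = scalem (a * b) f.
Proof.
rewrite scalemE [scalem b f]scalemE [RHS]scalemE compA; congr (_ ∘ _).
rewrite /scalem compA -[X in X ∘ λ⁻¹ _]compA; congr (_ ∘ _).
rewrite -!compA [λ⁻¹ X ∘ _]compA lunitK comp1m.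
by rewrite -tensmM comp1m.
Qed.

Lemma scale1m (X : C) (f : endo X) : scalem 1 f = f.
Proof. by rewrite /scalem lunit_nat -compA lunitVK compm1. Qed.

Lemma scalemDr (X : C) (a : ground C) (f g : endo X) :
  scalem a (f + g) = scalem a f + scalem a g.
Proof. by rewrite /scalem tensmDr compDr compDl. Qed.

Lemma scalemDl (X : C) (f : endo X) (a b : ground C) :
  scalem (a + b) f = scalem a f + scalem b f.
Proof. by rewrite /scalem tensmDl compDr compDl. Qed.

End KModule.

HB.instance Definition _ (C : tensorAbCat) (X : C) :=
  GRing.Zmodule_isLmodule.Build (ground C) (endo X)
    (@scalemA C X) (@scale1m C X) (@scalemDr C X) (@scalemDl C X).

Record ribbonAbCat := RibbonAbCat {
  rib_base :> tensorAbCat;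

  braid : forall X Y : rib_base, hom (X ⊗ Y) (Y ⊗ X);
  braidV : forall X Y : rib_base, hom (Y ⊗ X) (X ⊗ Y);
  braidK : forall X Y : rib_base, braidV X Y ∘ braid X Y = Id (X ⊗ Y);
  braidVK : forall X Y : rib_base, braid X Y ∘ braidV X Y = Id (Y ⊗ X);
  braid_nat : forall (X Y X' Y' : rib_base) (f : hom X X') (g : hom Y Y'),
    braid X' Y' ∘ (f ⊗ᵐ g) = (g ⊗ᵐ f) ∘ braid X Y;
  hexagon1 : forall X Y Z : rib_base,
    α Y Z X ∘ braid X (Y ⊗ Z) ∘ α X Y Z
    = (Id Y ⊗ᵐ braid X Z) ∘ α Y X Z ∘ (braid X Y ⊗ᵐ Id Z);
  hexagon2 : forall X Y Z : rib_base,
    α⁻¹ Z X Y ∘ braid (X ⊗ Y) Z ∘ α⁻¹ X Y Z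
    = (braid X Z ⊗ᵐ Id Y) ∘ α⁻¹ X Z Y ∘ (Id X ⊗ᵐ braid Y Z);

  dual : rib_base -> rib_base;
  coev : forall V : rib_base, hom 𝟙 (V ⊗ dual V);
  ev : forall V : rib_base, hom (dual V ⊗ V) 𝟙;
  zigzag1 : forall V : rib_base,
    ρ V ∘ (Id V ⊗ᵐ ev V) ∘ α V (dual V) V ∘ (coev V ⊗ᵐ Id V) ∘ λ⁻¹ V
    = Id V;
  zigzag2 : forall V : rib_base,
    λ (dual V) ∘ (ev V ⊗ᵐ Id (dual V)) ∘ α⁻¹ (dual V) V (dual V)
      ∘ (Id (dual V) ⊗ᵐ coev V) ∘ ρ⁻¹ (dual V)
    = Id (dual V);

  twist : forall V : rib_base, hom V V;
  twistV : forall V : rib_base, hom V V;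
  twistK : forall V : rib_base, twistV V ∘ twist V = Id V;
  twistVK : forall V : rib_base, twist V ∘ twistV V = Id V;
  twist_nat : forall (V W : rib_base) (f : hom V W),
    twist W ∘ f = f ∘ twist V;
  twist_tens : forall V W : rib_base,
    twist (V ⊗ W) = braid W V ∘ braid V W ∘ (twist V ⊗ᵐ twist W);
  twist_dual : forall V : rib_base,
    (twist V ⊗ᵐ Id (dual V)) ∘ coev V = (Id V ⊗ᵐ twist (dual V)) ∘ coev V
}.

Notation "V ^⋆" := (dual V) (at level 2, left associativity, format "V ^⋆").

Section Ribbon.
Variable C : ribbonAbCat.
Implicit Types J U V W : C.

Definition coev' V : hom 𝟙 (V^⋆ ⊗ V) :=
  (Id V^⋆ ⊗ᵐ twist V) ∘ braid V V^⋆ ∘ coev V.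

Definition ev' V : hom (V ⊗ V^⋆) 𝟙 :=
  ev V ∘ braid V V^⋆ ∘ (twist V ⊗ᵐ Id V^⋆).

(* Partial traces; the usual formulas with unit and associativity constraints
   inserted. *)
Definition trL V W (f : endo (V ⊗ W)) : endo W :=
  λ W ∘ (ev V ⊗ᵐ Id W) ∘ α⁻¹ V^⋆ V W ∘ (Id V^⋆ ⊗ᵐ (f : hom _ _)) ∘ α V^⋆ V W
    ∘ (coev' V ⊗ᵐ Id W) ∘ λ⁻¹ W.

Definition trR V W (f : endo (V ⊗ W)) : endo V :=
  ρ V ∘ (Id V ⊗ᵐ ev' W) ∘ α V W W^⋆ ∘ ((f : hom _ _) ⊗ᵐ Id W^⋆) ∘ α⁻¹ V W W^⋆
    ∘ (Id V ⊗ᵐ coev W) ∘ ρ⁻¹ V.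

Definition in_ideal J U : Prop :=
  exists (W : C) (a : hom U (J ⊗ W)) (b : hom (J ⊗ W) U), b ∘ a = Id U.

Definition ambidextrous_trace V (t : endo V -> ground C) : Prop :=
  scalar t /\ forall f : endo (V ⊗ V), t (trL f) = t (trR f).

(* p induces an isomorphism of K-algebras End(J)/Rad(End(J)) ≅ K; such a p is
   unique, as End(J) is then the sum of K Id_J and Rad(End(J)). *)
Definition residue_map J (p : endo J -> ground C) : Prop :=
  [/\ scalar p,
      p 1 = 1 /\ {morph p : f g / f * g},
      forall k : ground C, exists f, p f = k
    & forall f, p f = 0 <-> Rad (endo J) f].

Definition absolutely_indecomposable J : Prop :=
  exists p : endo J -> ground C, residue_map p.

Definition bracket J (hJ : absolutely_indecomposable J) : endo J -> ground C :=
  sval (cid hJ).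

Record ambidextrous J : Prop := Ambidextrous {
  ambi_indec : absolutely_indecomposable J;
  ambi_trace : ambidextrous_trace (bracket ambi_indec);
  ambi_neq0 : exists f : endo J, bracket ambi_indec f <> 0
}.

(* Computed from an arbitrarily chosen retraction; for ambidextrous J the value
   does not depend on it. *)
Definition mdim J (hJ : ambidextrous J) V (hV : in_ideal J V) : ground C :=
  let: exist W hW := cid hV in
  let: exist a ha := cid hW in
  let: exist b _ := cid ha in
  bracket (ambi_indec hJ) (trR (a ∘ b : endo (J ⊗ W))).

End Ribbon.

(* Main.v *)
(* Everything rests on one identity. Let [a : V -> J ⊗ W], [b] go back, and
   [i : J -> V ⊗ Y], [r] go back. Then [r (b a ⊗ Y) i] and the partial trace of
   [a (tr_Y (i r)) b] are the left and the right partial trace of a single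
   endomorphism of [J ⊗ J], built from [a], [b], [i], [r] and a braiding corrected
   by an inverse twist; so the ambidextrous trace takes the same value on both.
   If [V] is a retract of [J ⊗ W] with scalar endomorphisms and [J] is a retract
   of [V ⊗ Y], the value is 1 and hence the modified dimension of [V] is
   non-zero. Conversely, if the modified dimension of any [U] is non-zero, then
   [tr_W (a b)] is invertible and factors through [U ⊗ W^⋆], so [J] is a retract
   of [U ⊗ W^⋆]. In particular "[J] lies in the ideal of [V]" is equivalent to
   [d_J(V) <> 0] and to the splitting of [d_V ⊗ J]; (1) and (3) follow without
   knowing that the modified dimension is independent of the choices. *)

Require Import Defs.
From HB Require Import structures.
From mathcomp Require Import all_boot all_algebra.
From mathcomp Require Import boolp.
(* Repeated so that [hom] and [comp] are those of the category. *)
Require Import Defs.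

Set Implicit Arguments.
Unset Strict Implicit.
Unset Printing Implicit Defensive.

Import GRing.Theory.
Local Open Scope ring_scope.

Local Notation "A ◁ f" := (Id A ⊗ᵐ f) (at level 42, right associativity).
Local Notation "f ▷ A" := (f ⊗ᵐ Id A) (at level 40, left associativity).

(** * Composition and cancellation in a category *)

Section Rewriting.
Variable C : abCat.
Implicit Types X Y Z T S : C.

(* Composites are kept left-nested, so an equation for an inner factor [f ∘ g]
   has to be applied below a prefix [k]. *)
Lemma rw2 X Y Z T (f : hom Y Z) (g : hom X Y) h (k : hom Z T) :
  f ∘ g = h -> k ∘ f ∘ g = k ∘ h.
Proof. by move=> <-; rewrite compA. Qed.

Lemma rw3 X Y Z T S (f : hom Z T) (g : hom Y Z) (g' : hom X Y) h (k : hom T S) :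
  f ∘ g ∘ g' = h -> k ∘ f ∘ g ∘ g' = k ∘ h.
Proof. by move=> <-; rewrite !compA. Qed.

Lemma splitK X Y Z (f : hom Y X) (g : hom X Y) (k : hom X Z) :
  f ∘ g = Id X -> k ∘ f ∘ g = k.
Proof. by move=> /rw2 ->; rewrite compm1. Qed.

Lemma split_mono X Y Z (f : hom Y X) (g : hom X Y) (h k : hom Z X) :
  f ∘ g = Id X -> g ∘ h = g ∘ k -> h = k.
Proof. by move=> fg /(congr1 (comp f)); rewrite !compA fg !comp1m. Qed.

Lemma split_epi X Y Z (f : hom Y X) (g : hom X Y) (h k : hom X Z) :
  f ∘ g = Id X -> h ∘ f = k ∘ f -> h = k.
Proof. by move=> fg /(congr1 (fun u => u ∘ g)); rewrite -!compA fg !compm1. Qed.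

End Rewriting.

(** * Coherence in a monoidal category *)

Section Monoidal.
Variable C : tensorAbCat.
Implicit Types A B D E U V W X Y Z : C.

Lemma lwM A X Y Z (g : hom Y Z) (f : hom X Y) :
  A ◁ (g ∘ f) = (A ◁ g) ∘ (A ◁ f).
Proof. by rewrite -tensmM comp1m. Qed.

Lemma rwM A X Y Z (g : hom Y Z) (f : hom X Y) :
  (g ∘ f) ▷ A = (g ▷ A) ∘ (f ▷ A).
Proof. by rewrite -tensmM comp1m. Qed.

Lemma interchange A B X Y (f : hom A B) (g : hom X Y) :
  (B ◁ g) ∘ (f ▷ X) = (f ▷ Y) ∘ (A ◁ g).
Proof. by rewrite -!tensmM !comp1m !compm1. Qed.

Lemma lw_can A X Y (f : hom X Y) (g : hom Y X) :
  g ∘ f = Id X -> (A ◁ g) ∘ (A ◁ f) = Id (A ⊗ X).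
Proof. by rewrite -lwM => ->; rewrite tensm1. Qed.

Lemma rw_can A X Y (f : hom X Y) (g : hom Y X) :
  g ∘ f = Id X -> (g ▷ A) ∘ (f ▷ A) = Id (X ⊗ A).
Proof. by rewrite -rwM => ->; rewrite tensm1. Qed.

(** Allows an identity to be proved after whiskering, where the pentagon and the action forms below
    apply. *)
Lemma rwhisker_unit_inj X Y (f g : hom X Y) :
  f ▷ 𝟙 = g ▷ 𝟙 -> f = g.
Proof.
move=> /(congr1 (comp (ρ Y))); rewrite !runit_nat.
exact: split_epi (runitVK X).
Qed.

Lemma lwhisker_unit_inj X Y (f g : hom X Y) :
  𝟙 ◁ f = 𝟙 ◁ g -> f = g.
Proof.
move=> /(congr1 (comp (λ Y))); rewrite !lunit_nat.
exact: split_epi (lunitVK X).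
Qed.

Lemma assoc_natl A A' B D (f : hom A A') :
  α A' B D ∘ ((f ▷ B) ▷ D) = (f ▷ (B ⊗ D)) ∘ α A B D.
Proof. by rewrite assoc_nat tensm1. Qed.

Lemma assocV_nat A B D A' B' D' (f : hom A A') (g : hom B B') (h : hom D D') :
  α⁻¹ A' B' D' ∘ (f ⊗ᵐ (g ⊗ᵐ h)) = ((f ⊗ᵐ g) ⊗ᵐ h) ∘ α⁻¹ A B D.
Proof.
apply: (split_mono (assocK _ _ _)).
by rewrite !compA assocVK comp1m assoc_nat -compA assocVK compm1.
Qed.

Lemma lunitV_nat X Y (f : hom X Y) : λ⁻¹ Y ∘ f = (𝟙 ◁ f) ∘ λ⁻¹ X.
Proof.
apply: (split_mono (lunitK _)).
by rewrite !compA lunitVK comp1m lunit_nat -compA lunitVK compm1.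
Qed.

Lemma runitV_nat X Y (f : hom X Y) : ρ⁻¹ Y ∘ f = (f ▷ 𝟙) ∘ ρ⁻¹ X.
Proof.
apply: (split_mono (runitK _)).
by rewrite !compA runitVK comp1m runit_nat -compA runitVK compm1.
Qed.

(** Kelly's argument: whiskered by [𝟙], both sides are compared through the pentagon at [𝟙, 𝟙, X, Y]
    and two triangles. *)
Lemma lunit_tens X Y : λ (X ⊗ Y) ∘ α 𝟙 X Y = λ X ▷ Y.
Proof.
apply: lwhisker_unit_inj; rewrite lwM.
apply: (split_epi (assocVK 𝟙 (𝟙 ⊗ X) Y)).
apply: (split_epi (rw_can Y (assocVK 𝟙 𝟙 X))).
rewrite (rw3 _ (esym (pentagon 𝟙 𝟙 X Y))) !compA triangle.
rewrite -assoc_nat [RHS](rw2 _ (esym (rwM _ _ _))) triangle.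
by rewrite -tensm1 -assoc_nat.
Qed.

End Monoidal.

Lemma lunitV_tens (C : tensorAbCat) (X Y : C) :
  α 𝟙 X Y ∘ (λ⁻¹ X ▷ Y) = λ⁻¹ (X ⊗ Y).
Proof.
apply: (split_mono (lunitK _)).
by rewrite compA lunit_tens rw_can ?lunitVK.
Qed.

(* Objects are kept right-nested, [A ⊗ (B ⊗ (... ⊗ X))]; [actmn f X] applies a
   morphism [f] with [m] inputs and [n] outputs to the leftmost factors. In this
   form associators and units disappear, and naturality in [X] is the
   interchange law of the graphical calculus. *)
HB.lock Definition act21 (C : tensorAbCat) (A B D : C)
  (f : hom (A ⊗ B) D) (X : C) : hom (A ⊗ (B ⊗ X)) (D ⊗ X) :=
  (f ▷ X) ∘ α⁻¹ A B X.
HB.lock Definition act12 (C : tensorAbCat) (A D E : C)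
  (f : hom A (D ⊗ E)) (X : C) : hom (A ⊗ X) (D ⊗ (E ⊗ X)) :=
  α D E X ∘ (f ▷ X).
HB.lock Definition act22 (C : tensorAbCat) (A B D E : C)
  (f : hom (A ⊗ B) (D ⊗ E)) (X : C) : hom (A ⊗ (B ⊗ X)) (D ⊗ (E ⊗ X)) :=
  α D E X ∘ (f ▷ X) ∘ α⁻¹ A B X.
HB.lock Definition act20 (C : tensorAbCat) (A B : C)
  (f : hom (A ⊗ B) 𝟙) (X : C) : hom (A ⊗ (B ⊗ X)) X :=
  λ X ∘ (f ▷ X) ∘ α⁻¹ A B X.
HB.lock Definition act02 (C : tensorAbCat) (D E : C)
  (f : hom 𝟙 (D ⊗ E)) (X : C) : hom X (D ⊗ (E ⊗ X)) :=
  α D E X ∘ (f ▷ X) ∘ λ⁻¹ X.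

(** * Naturality and functoriality of the actions on leftmost factors *)

Section Monoidal.
Variable C : tensorAbCat.
Implicit Types A B D E U V W X Y Z : C.

Lemma act20E A B X (e : hom (A ⊗ B) 𝟙) : act20 e X = λ X ∘ act21 e X.
Proof. by rewrite act20.unlock act21.unlock compA. Qed.

Lemma act02E D E X (n : hom 𝟙 (D ⊗ E)) : act02 n X = act12 n X ∘ λ⁻¹ X.
Proof. by rewrite act02.unlock act12.unlock. Qed.

Section Naturality.
Variables (X Y : C) (h : hom X Y).

Lemma act21_nat A B D (f : hom (A ⊗ B) D) :
  act21 f Y ∘ (A ◁ B ◁ h) = (D ◁ h) ∘ act21 f X.
Proof.
by rewrite act21.unlock -compA assocV_nat tensm1 !compA interchange.
Qed.

Lemma act12_nat A D E (f : hom A (D ⊗ E)) :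
  act12 f Y ∘ (A ◁ h) = (D ◁ E ◁ h) ∘ act12 f X.
Proof.
by rewrite act12.unlock compA -assoc_nat tensm1 -!compA interchange.
Qed.

Lemma act22_nat A B D E (f : hom (A ⊗ B) (D ⊗ E)) :
  act22 f Y ∘ (A ◁ B ◁ h) = (D ◁ E ◁ h) ∘ act22 f X.
Proof.
rewrite act22.unlock (rw2 _ (assocV_nat _ _ _)) tensm1 !compA -assoc_nat tensm1.
by rewrite (rw2 _ (interchange _ _)) !compA.
Qed.

Lemma act20_nat A B (f : hom (A ⊗ B) 𝟙) :
  act20 f Y ∘ (A ◁ B ◁ h) = h ∘ act20 f X.
Proof.
rewrite act20.unlock (rw2 _ (assocV_nat _ _ _)) tensm1 !compA -lunit_nat.
by rewrite (rw2 _ (interchange _ _)) !compA.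
Qed.

Lemma act02_nat D E (f : hom 𝟙 (D ⊗ E)) :
  act02 f Y ∘ h = (D ◁ E ◁ h) ∘ act02 f X.
Proof.
rewrite act02.unlock (rw2 _ (lunitV_nat _)) !compA -assoc_nat tensm1.
by rewrite (rw2 _ (interchange _ _)) !compA.
Qed.

End Naturality.

Section Functoriality.
Variable X : C.

Lemma act21_comp22 A B A' B' D (g : hom (A' ⊗ B') D) (f : hom (A ⊗ B) (A' ⊗ B')) :
  act21 (g ∘ f) X = act21 g X ∘ act22 f X.
Proof. by rewrite act21.unlock act22.unlock !compA (splitK _ (assocK _ _ _)) -rwM. Qed.

Lemma act21_comp A B D E (g : hom D E) (f : hom (A ⊗ B) D) :
  act21 (g ∘ f) X = (g ▷ X) ∘ act21 f X.
Proof. by rewrite act21.unlock compA -rwM. Qed.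

Lemma act22_comp12 A B D E F (g : hom F (D ⊗ E)) (f : hom (A ⊗ B) F) :
  act22 (g ∘ f) X = act12 g X ∘ act21 f X.
Proof.
by rewrite act22.unlock act12.unlock act21.unlock !compA (rw2 _ (esym (rwM _ _ _))).
Qed.

Lemma act22_comp A B D E A' B' (g : hom (A' ⊗ B') (D ⊗ E))
    (f : hom (A ⊗ B) (A' ⊗ B')) :
  act22 (g ∘ f) X = act22 g X ∘ act22 f X.
Proof.
rewrite act22.unlock !compA (splitK _ (assocK _ _ _)).
by rewrite (rw2 _ (esym (rwM _ _ _))).
Qed.

Lemma act20_comp A B A' B' (g : hom (A' ⊗ B') 𝟙) (f : hom (A ⊗ B) (A' ⊗ B')) :
  act20 (g ∘ f) X = act20 g X ∘ act22 f X.
Proof.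
rewrite act20.unlock act22.unlock !compA (splitK _ (assocK _ _ _)).
by rewrite (rw2 _ (esym (rwM _ _ _))).
Qed.

Lemma act02_comp D E A' B' (g : hom (A' ⊗ B') (D ⊗ E)) (f : hom 𝟙 (A' ⊗ B')) :
  act02 (g ∘ f) X = act22 g X ∘ act02 f X.
Proof.
rewrite act02.unlock act22.unlock !compA (splitK _ (assocK _ _ _)).
by rewrite (rw2 _ (esym (rwM _ _ _))).
Qed.

Lemma act22_rw A B D (f : hom A B) : act22 (f ▷ D) X = f ▷ (D ⊗ X).
Proof.
by rewrite act22.unlock assoc_nat tensm1 -compA assocVK compm1.
Qed.

Lemma act22_lw A B D (f : hom A B) : act22 (D ◁ f) X = D ◁ (f ▷ X).
Proof. by rewrite act22.unlock assoc_nat -compA assocVK compm1. Qed.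

(** Merges two successive tails into one; [trR_cyc] needs it for a coupon that sits beside [Y]
    inside a trace. *)
Lemma act22_act22 A B D E Y (f : hom (A ⊗ B) (D ⊗ E)) :
  act22 (act22 f Y) X = (D ◁ α⁻¹ E Y X) ∘ act22 f (Y ⊗ X) ∘ (A ◁ α B Y X).
Proof.
apply: (split_mono (lw_can D (assocK _ _ _))).
apply: (split_epi (assocVK A (B ⊗ Y) X)).
apply: (split_epi (rw_can X (assocVK A B Y))).
rewrite !compA lw_can ?assocVK // comp1m.
rewrite (rw3 _ (esym (pentagon _ _ _ _))) act22.unlock !compA.
rewrite (splitK _ (assocK _ _ _)) (splitK _ (assocK _ _ _)).
rewrite !rwM !compA -pentagon.
rewrite (splitK _ (rw_can X (assocK _ _ _))).
by rewrite (rw2 _ (assoc_nat _ _ _)) tensm1 compA.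
Qed.

End Functoriality.
End Monoidal.

(** * Caps and cups *)

Section Bending.
Variable C : tensorAbCat.
Implicit Types A B D E U V W X Y Z : C.

Lemma triangleV A X : α A 𝟙 X ∘ (ρ⁻¹ A ▷ X) = A ◁ λ⁻¹ X.
Proof.
apply: (split_mono (lw_can A (lunitK X))).
by rewrite compA triangle rw_can ?runitVK // lw_can ?lunitVK.
Qed.

(** The left side has the shape in which caps occur in [zigzag1] and [trR]; this converts it to
    action form, and [lw_cup_rw] does so for cups. *)
Lemma lw_cap_rw A B D X (e : hom (B ⊗ D) 𝟙) :
  (ρ A ∘ (A ◁ e) ∘ α A B D) ▷ X
  = (A ◁ act20 e X) ∘ α A B (D ⊗ X) ∘ α (A ⊗ B) D X.
Proof.
rewrite !rwM -triangle (rw2 _ (assoc_nat _ _ _)) !compA -lwM.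
rewrite (rw2 _ (pentagon _ _ _ _)) !compA -lwM.
by rewrite act20.unlock (splitK _ (assocK _ _ _)).
Qed.

Lemma lw_cup_rw A B D X (n : hom 𝟙 (B ⊗ D)) :
  (α⁻¹ A B D ∘ (A ◁ n) ∘ ρ⁻¹ A) ▷ X
  = α⁻¹ (A ⊗ B) D X ∘ α⁻¹ A B (D ⊗ X) ∘ (A ◁ act02 n X).
Proof.
apply: (split_mono (assocK (A ⊗ B) D X)).
apply: (split_mono (assocK A B (D ⊗ X))).
rewrite !compA (splitK _ (assocVK _ _ _)) assocVK comp1m.
rewrite pentagon !rwM !compA (splitK _ (rw_can X (assocVK _ _ _))).
rewrite (rw2 _ (assoc_nat _ _ _)) !compA (rw2 _ (triangleV _ _)).
by rewrite act02.unlock !lwM.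
Qed.

Lemma act20_rw A B W X (e : hom (A ⊗ B) 𝟙) :
  act20 e W ▷ X = act20 e (W ⊗ X) ∘ (A ◁ α B W X) ∘ α A (B ⊗ W) X.
Proof.
apply: (split_epi (rw_can X (assocVK A B W))).
rewrite (rw3 _ (esym (pentagon _ _ _ _))) act20.unlock !compA.
rewrite (splitK _ (assocK _ _ _)) !rwM (splitK _ (rw_can X (assocK _ _ _))).
by rewrite -lunit_tens (rw2 _ (assoc_nat _ _ _)) tensm1 compA.
Qed.

Lemma act02_rw D E W X (n : hom 𝟙 (D ⊗ E)) :
  α D (E ⊗ W) X ∘ (act02 n W ▷ X) = (D ◁ α⁻¹ E W X) ∘ act02 n (W ⊗ X).
Proof.
apply: (split_mono (lw_can D (assocK E W X))).
rewrite !compA lw_can ?assocVK // comp1m.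
apply: (split_epi (lunitVK (W ⊗ X))).
rewrite {2}act02.unlock (splitK _ (lunitK _)).
apply: (split_epi (assocVK 𝟙 W X)).
rewrite (rw2 _ (lunit_tens _ _)) act02.unlock !rwM !compA.
rewrite (splitK _ (rw_can X (lunitK _))) -pentagon.
by rewrite (rw2 _ (assoc_nat _ _ _)) tensm1 compA.
Qed.

End Bending.

(** * Braidings *)

HB.lock Definition braidX (C : ribbonAbCat) (U V X : C) := act22 (braid U V) X.

Section Braiding.
Variable C : ribbonAbCat.
Implicit Types A B D E U V W X Y Z : C.

(** In the first hexagon at [U, 𝟙, 𝟙] one invertible factor [braid U 𝟙] cancels. *)
Lemma braid_unit U : λ U ∘ braid U 𝟙 = ρ U.
Proof.
apply: rwhisker_unit_inj; rewrite rwM.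
apply: (split_mono (braidK U 𝟙)); rewrite compA.
have := congr1 (comp (λ (𝟙 ⊗ U))) (hexagon1 U 𝟙 𝟙).
rewrite !compA lunit_tens lunit_nat (rw2 _ (lunit_tens _ _)).
by rewrite -braid_nat (rw2 _ (triangle _ _)).
Qed.

Lemma braidXE U V X : braidX U V X = act22 (braid U V) X.
Proof. by rewrite braidX.unlock. Qed.

Lemma braidX_nat U V X Y (h : hom X Y) :
  braidX U V Y ∘ (U ◁ V ◁ h) = (V ◁ U ◁ h) ∘ braidX U V X.
Proof. by rewrite braidX.unlock; exact: act22_nat. Qed.

Lemma braidX_natl U U' V X (f : hom U U') :
  braidX U' V X ∘ (f ▷ (V ⊗ X)) = (V ◁ (f ▷ X)) ∘ braidX U V X.
Proof. by rewrite braidX.unlock -act22_rw -act22_lw -!act22_comp braid_nat. Qed.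

Lemma braidX_natr U V V' X (f : hom V V') :
  braidX U V' X ∘ (U ◁ (f ▷ X)) = (f ▷ (U ⊗ X)) ∘ braidX U V X.
Proof. by rewrite braidX.unlock -act22_rw -act22_lw -!act22_comp braid_nat. Qed.

(** Action form of the first hexagon; [braidX_tensl] is that of the second. *)
Lemma braidX_tensr U A B X :
  α A B (U ⊗ X) ∘ braidX U (A ⊗ B) X
  = (A ◁ braidX U B X) ∘ braidX U A (B ⊗ X) ∘ (U ◁ α A B X).
Proof.
apply: (split_epi (assocVK U (A ⊗ B) X)).
apply: (split_epi (rw_can X (assocVK U A B))).
rewrite (rw3 _ (esym (pentagon _ _ _ _))) braidX.unlock act22.unlock !compA.
rewrite (splitK _ (assocK _ _ _)) (splitK _ (assocK _ _ _)) pentagon.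
rewrite -[LHS]compA -rwM -[LHS]compA -rwM compA hexagon1 !rwM !compA lwM.
rewrite (rw2 _ (assoc_nat _ _ _)) !lwM !compA (rw2 _ (esym (assoc_natl _ _ _))).
rewrite !compA (rw2 _ (pentagon _ _ _ _)) !compA.
by rewrite (splitK _ (lw_can A (assocK _ _ _))).
Qed.

Lemma braidX_tensl U A B X :
  (U ◁ α A B X) ∘ braidX (A ⊗ B) U X
  = braidX A U (B ⊗ X) ∘ (A ◁ braidX B U X) ∘ α A B (U ⊗ X).
Proof.
have pent1 (P Q R S : C) : α⁻¹ P Q (R ⊗ S) ∘ (P ◁ α Q R S) ∘ α P (Q ⊗ R) S
    = α (P ⊗ Q) R S ∘ (α⁻¹ P Q R ▷ S).
  apply: (split_epi (rw_can S (assocVK P Q R))).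
  rewrite (rw3 _ (esym (pentagon _ _ _ _))) compA assocK comp1m.
  by rewrite (splitK _ (rw_can S (assocK _ _ _))).
have pent2 (P Q R S : C) : (P ◁ α⁻¹ Q R S) ∘ α P Q (R ⊗ S) ∘ α (P ⊗ Q) R S
    = α P (Q ⊗ R) S ∘ (α P Q R ▷ S).
  by rewrite (rw2 _ (pentagon _ _ _ _)) !compA lw_can ?assocK // comp1m.
apply: (split_epi (assocVK (A ⊗ B) U X)).
rewrite braidX.unlock act22.unlock !lwM !compA (splitK _ (assocK _ _ _)).
rewrite (rw3 _ (pent2 _ _ _ _)).
rewrite !compA (rw2 _ (esym (assoc_nat _ _ _))) !compA (rw3 _ (pent1 _ _ _ _)).
rewrite !compA (rw2 _ (esym (assoc_natl _ _ _))) !compA pentagon.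
rewrite -!compA; congr (_ ∘ (_ ∘ _)); rewrite -!rwM; congr (_ ▷ X).
have := congr1 (comp (α U A B)) (hexagon2 A B U).
move/(congr1 (fun f => f ∘ α A B U)).
by rewrite !compA assocVK comp1m (splitK _ (assocK _ _ _)) -!compA.
Qed.

Lemma braidX_unit U X : λ (U ⊗ X) ∘ braidX U 𝟙 X = U ◁ λ X.
Proof.
rewrite braidX.unlock act22.unlock !compA lunit_tens -rwM braid_unit.
by rewrite -triangle -compA assocVK compm1.
Qed.

(* A strand [U] passing over ([over..]) or under ([under..]) a coupon. *)
Section Crossing.
Variables (U X : C).

Lemma over21 A B D (f : hom (A ⊗ B) D) :
  braidX U D X ∘ (U ◁ act21 f X)
  = act21 f (U ⊗ X) ∘ (A ◁ braidX U B X) ∘ braidX U A (B ⊗ X).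
Proof.
rewrite act21.unlock lwM compA braidX_natr.
apply: (split_epi (lw_can U (assocVK A B X))).
rewrite (splitK _ (lw_can U (assocK A B X))).
by rewrite (rw3 _ (esym (braidX_tensr _ _ _ _))) !compA (splitK _ (assocK _ _ _)).
Qed.

Lemma over12 A D E (f : hom A (D ⊗ E)) :
  (D ◁ braidX U E X) ∘ braidX U D (E ⊗ X) ∘ (U ◁ act12 f X)
  = act12 f (U ⊗ X) ∘ braidX U A X.
Proof.
by rewrite act12.unlock lwM compA -braidX_tensr (rw2 _ (braidX_natr _ _ _)) !compA.
Qed.

Lemma over22 A B D E (f : hom (A ⊗ B) (D ⊗ E)) :
  (D ◁ braidX U E X) ∘ braidX U D (E ⊗ X) ∘ (U ◁ act22 f X)
  = act22 f (U ⊗ X) ∘ (A ◁ braidX U B X) ∘ braidX U A (B ⊗ X).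
Proof.
rewrite -[f in LHS]compm1 -[f in RHS]compm1 !act22_comp12 lwM compA over12.
by rewrite (rw2 _ (over21 _)) !compA.
Qed.

Lemma braidX_unitV : braidX U 𝟙 X ∘ (U ◁ λ⁻¹ X) = λ⁻¹ (U ⊗ X).
Proof.
apply: (split_mono (lunitK _)).
by rewrite compA braidX_unit lw_can ?lunitVK.
Qed.

(** The case of [over22] whose coupon is itself a crossing. *)
Lemma braidX_yang_baxter A B :
  (B ◁ braidX U A X) ∘ braidX U B (A ⊗ X) ∘ (U ◁ braidX A B X)
  = braidX A B (U ⊗ X) ∘ (A ◁ braidX U B X) ∘ braidX U A (B ⊗ X).
Proof. by rewrite ![braidX A B _]braidXE over22. Qed.

Lemma over20 A B (e : hom (A ⊗ B) 𝟙) :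
  U ◁ act20 e X = act20 e (U ⊗ X) ∘ (A ◁ braidX U B X) ∘ braidX U A (B ⊗ X).
Proof.
by rewrite !act20E lwM -braidX_unit (rw2 _ (over21 e)) !compA.
Qed.

Lemma over02 D E (n : hom 𝟙 (D ⊗ E)) :
  (D ◁ braidX U E X) ∘ braidX U D (E ⊗ X) ∘ (U ◁ act02 n X) = act02 n (U ⊗ X).
Proof.
by rewrite !act02E lwM compA over12 (rw2 _ (braidX_unitV)).
Qed.

Lemma under21 A B D (f : hom (A ⊗ B) D) :
  braidX D U X ∘ act21 f (U ⊗ X)
  = (U ◁ act21 f X) ∘ braidX A U (B ⊗ X) ∘ (A ◁ braidX B U X).
Proof.
apply: (split_epi (assocVK A B (U ⊗ X))).
rewrite act21.unlock !compA (splitK _ (assocK _ _ _)) braidX_natl lwM.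
rewrite (rw3 _ (esym (braidX_tensl _ _ _ _))) !compA.
by rewrite (splitK _ (lw_can U (assocK _ _ _))).
Qed.

End Crossing.

Section Duality.
Variables (V X : C).

Lemma act_zigzag :
  (V ◁ act20 (ev V) X) ∘ act02 (coev V) (V ⊗ X) = Id (V ⊗ X).
Proof.
rewrite -tensm1 -[in RHS](zigzag1 V) rwM rwM lw_cap_rw.
rewrite (rw2 _ (assoc_natl _ _ _)) !compA (rw2 _ (lunitV_tens _ _)).
by rewrite act02.unlock !compA.
Qed.

End Duality.

End Braiding.

(** * Partial traces *)

Local Notation evX V := (act20 (ev V)).
Local Notation ev'X V := (act20 (ev' V)).
Local Notation coevX V := (act02 (coev V)).
Local Notation coev'X V := (act02 (coev' V)).

Section Traces.
Variable C : ribbonAbCat.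
Implicit Types A B J U V W X Y Z : C.

(** Puts the trace in action form; by [rwhisker_unit_inj] nothing is lost at [X = 𝟙]. *)
Lemma trRE V W X (f : endo (V ⊗ W)) :
  trR f ▷ X = (V ◁ ev'X W X) ∘ act22 f (W^⋆ ⊗ X) ∘ (V ◁ coevX W X).
Proof.
have -> : trR f = (ρ V ∘ (V ◁ ev' W) ∘ α V W W^⋆) ∘ ((f : hom _ _) ▷ W^⋆)
    ∘ (α⁻¹ V W W^⋆ ∘ (V ◁ coev W) ∘ ρ⁻¹ V).
  by rewrite /trR !compA.
rewrite rwM rwM lw_cap_rw lw_cup_rw !compA (rw2 _ (assoc_natl _ _ _)) !compA.
by rewrite (splitK _ (assocVK _ _ _)) act22.unlock !compA.
Qed.

Lemma trLE V W (f : endo (V ⊗ W)) :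
  trL f = evX V W ∘ (V^⋆ ◁ (f : hom _ _)) ∘ coev'X V W.
Proof. by rewrite /trL act20.unlock act02.unlock !compA. Qed.

Lemma trL_rw V W X (f : endo (V ⊗ W)) :
  trL f ▷ X = evX V (W ⊗ X) ∘ (V^⋆ ◁ act22 f X) ∘ coev'X V (W ⊗ X).
Proof.
rewrite trLE rwM rwM act20_rw (rw2 _ (assoc_nat _ _ _)) !compA.
by rewrite (rw2 _ (act02_rw _ _ _)) act22.unlock !lwM !compA.
Qed.

(** Only [A] is closed up, so [r] and [i] lie on the open strands and slide out by naturality. *)
Lemma trL_slide A J V Y (h : endo (A ⊗ V)) (r : hom (V ⊗ Y) J)
    (i : hom J (V ⊗ Y)) :
  trL ((A ◁ r) ∘ act22 h Y ∘ (A ◁ i) : endo (A ⊗ J)) = r ∘ (trL h ▷ Y) ∘ i.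
Proof.
rewrite trLE trL_rw !lwM !compA act20_nat.
by rewrite (rw2 _ (esym (act02_nat _ _))) !compA.
Qed.

Lemma trR_comp V W (g : endo V) (f : endo (V ⊗ W)) :
  trR ((g ▷ W) ∘ f : endo (V ⊗ W)) = g ∘ trR f.
Proof.
apply: rwhisker_unit_inj; rewrite rwM !trRE act22_comp act22_rw !compA.
by rewrite interchange.
Qed.

Lemma ev'XE V X : ev'X V X = evX V X ∘ braidX V V^⋆ X ∘ (twist V ▷ (V^⋆ ⊗ X)).
Proof. by rewrite /ev' !act20_comp act22_rw braidX.unlock. Qed.

Lemma coev'XE V X :
  coev'X V X = (V^⋆ ◁ (twist V ▷ X)) ∘ braidX V V^⋆ X ∘ coevX V X.
Proof. by rewrite /coev' !act02_comp act22_comp act22_lw braidX.unlock. Qed.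

(** Closing one strand of a crossing leaves a kink; the inverse twist removes it for both partial
    traces. *)
Definition twisted_braid A : endo (A ⊗ A) := braid A A ∘ (twistV A ▷ A).

(** The inverse twist cancels the twist in [coev']; the two remaining crossings are absorbed by
    [over20], which leaves a zig-zag. *)
Lemma trL_twisted_braid A : trL (twisted_braid A) = Id A.
Proof.
apply: rwhisker_unit_inj.
rewrite trL_rw /twisted_braid act22_comp act22_rw lwM coev'XE !compA.
rewrite (splitK _ (lw_can _ (rw_can _ (twistK _)))) -braidXE.
by rewrite -over20 act_zigzag tensm1.
Qed.

Lemma trR_twisted_braid A : trR (twisted_braid A) = Id A.
Proof.
apply: rwhisker_unit_inj.
rewrite trRE /twisted_braid act22_comp act22_rw ev'XE !compA !lwM.
rewrite -braidXE (rw2 _ (esym (braidX_natl _ _ _))) !compA.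
rewrite (splitK _ (rw_can _ (twistVK _))).
by rewrite (rw3 _ (over02 _ _ _)) act_zigzag tensm1.
Qed.

Section Mate.
Variables (J V Y : C) (r : hom (V ⊗ Y) J).

(* The dual of [r : V ⊗ Y -> J], applied to the left of [X]. *)
Definition mate X : hom (J^⋆ ⊗ X) (Y^⋆ ⊗ (V^⋆ ⊗ X)) :=
  evX J (Y^⋆ ⊗ (V^⋆ ⊗ X)) ∘
  (J^⋆ ◁ (act21 r (Y^⋆ ⊗ (V^⋆ ⊗ X)) ∘ (V ◁ coevX Y (V^⋆ ⊗ X)) ∘ coevX V X)).

Lemma mate_coev X :
  (J ◁ mate X) ∘ coevX J X
  = act21 r (Y^⋆ ⊗ (V^⋆ ⊗ X)) ∘ (V ◁ coevX Y (V^⋆ ⊗ X)) ∘ coevX V X.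
Proof.
by rewrite /mate lwM (rw2 _ (esym (act02_nat _ _))) compA act_zigzag comp1m.
Qed.

(** The two cups inside [mate] are straightened against the nested evaluations, by one zig-zag
    each. *)
Lemma ev_mate X :
  evX J X ∘ (J^⋆ ◁ act21 r X)
  = evX Y X ∘ (Y^⋆ ◁ evX V (Y ⊗ X)) ∘ mate (V ⊗ (Y ⊗ X)).
Proof.
rewrite /mate compA -(act20_nat (evX Y X ∘ _)) -[RHS]compA -lwM.
congr (_ ∘ (_ ◁ _)); rewrite !compA -act21_nat !lwM.
rewrite !compA (rw2 _ (esym (lwM _ _ _))) -act02_nat lwM compA.
rewrite (splitK _ (act_zigzag _ _)) (rw2 _ (esym (lwM _ _ _))).
by rewrite act_zigzag tensm1 compm1.
Qed.

Lemma braid_mate U X :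
  (Y^⋆ ◁ braidX U V^⋆ X) ∘ braidX U Y^⋆ (V^⋆ ⊗ X) ∘ (U ◁ mate X)
  = mate (U ⊗ X) ∘ braidX U J^⋆ X.
Proof.
(* The pair of crossings is kept opaque while it slides through the cap of [J], and is unfolded at
   the cups. *)
move Ew: ((Y^⋆ ◁ braidX U V^⋆ X) ∘ _) => w.
rewrite /mate lwM over20 !compA -[w ∘ _]act20_nat.
rewrite (rw2 _ (braidX_nat _ _ _)) !compA; congr (_ ∘ _).
rewrite -!compA -!lwM; congr (_ ∘ (_ ◁ _)).
rewrite !compA !lwM !compA (rw2 _ (over21 _ _ _)) !compA -act21_nat.
rewrite (rw2 _ (braidX_nat _ _ _)) -Ew !compA.
have over_coY : (V ◁ Y ◁ braidX U Y^⋆ (V^⋆ ⊗ X)) ∘ (V ◁ braidX U Y (Y^⋆ ⊗ (V^⋆ ⊗ X)))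
    ∘ (V ◁ U ◁ coevX Y (V^⋆ ⊗ X)) = V ◁ coevX Y (U ⊗ (V^⋆ ⊗ X)).
  by rewrite -!lwM over02.
have slide_coY : (V ◁ Y ◁ Y^⋆ ◁ braidX U V^⋆ X) ∘ (V ◁ coevX Y (U ⊗ (V^⋆ ⊗ X)))
    = (V ◁ coevX Y (V^⋆ ⊗ (U ⊗ X))) ∘ (V ◁ braidX U V^⋆ X).
  by rewrite -!lwM -act02_nat.
rewrite !lwM !compA (rw3 _ over_coY) (rw2 _ slide_coY) !compA.
by rewrite (rw3 _ (over02 _ _ _)).
Qed.

End Mate.

(* The twist of [V ⊗ Y] is what makes the right evaluations nest. *)
Lemma ev'X_nested V Y X :
  evX Y X ∘ (Y^⋆ ◁ evX V (Y ⊗ X)) ∘ (Y^⋆ ◁ braidX V V^⋆ (Y ⊗ X))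
    ∘ braidX V Y^⋆ (V^⋆ ⊗ (Y ⊗ X)) ∘ (V ◁ Y^⋆ ◁ braidX Y V^⋆ X)
    ∘ (V ◁ braidX Y Y^⋆ (V^⋆ ⊗ X)) ∘ act22 (twist (V ⊗ Y)) (Y^⋆ ⊗ (V^⋆ ⊗ X))
  = ev'X V X ∘ (V ◁ ev'X Y (V^⋆ ⊗ X)).
Proof.
(* [o Z] is the right evaluation without its twist. With Yang-Baxter, the two crossings from
   [twist_tens] are used up by one [over20] each. *)
pose o Z := act20 (ev Z ∘ braid Z Z^⋆).
have oE Z T : evX Z T ∘ braidX Z Z^⋆ T = o Z T by rewrite /o act20_comp braidXE.
have ev'E Z T : ev'X Z T = o Z T ∘ (twist Z ▷ (Z^⋆ ⊗ T)) by rewrite ev'XE oE.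
rewrite (rw2 _ (esym (lwM _ (evX V _) _))) oE (rw2 _ (braidX_nat _ _ _)) !compA.
rewrite twist_tens !act22_comp -!braidXE !compA.
rewrite (rw3 _ (esym (braidX_yang_baxter _ _ _ _))) !compA.
have slide_o : (Y^⋆ ◁ o V (Y ⊗ X)) ∘ (Y^⋆ ◁ V ◁ braidX Y V^⋆ X)
    ∘ (Y^⋆ ◁ braidX Y V (V^⋆ ⊗ X)) = Y^⋆ ◁ Y ◁ o V X by rewrite -!lwM -over20.
rewrite (rw3 _ slide_o) act20_nat (rw2 _ (oE _ _)) (rw3 _ (esym (over20 _ _ _))).
have -> : twist V ⊗ᵐ twist Y = (twist V ▷ Y) ∘ (V ◁ twist Y).
  by rewrite -tensmM comp1m compm1.
rewrite act22_comp act22_rw act22_lw !ev'E lwM !compA.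
by rewrite [in RHS](rw2 _ (esym (interchange _ _))) !compA.
Qed.

(** Naturality turns the twist of [J] into that of [V ⊗ Y]; then [r] passes under the crossing and
    round the cap, and [ev'X_nested] reassembles the two caps. *)
Lemma ev'X_slide J V Y (r : hom (V ⊗ Y) J) X :
  ev'X J X ∘ act21 r (J^⋆ ⊗ X)
  = ev'X V X ∘ (V ◁ ev'X Y (V^⋆ ⊗ X)) ∘ (V ◁ Y ◁ mate r X).
Proof.
rewrite ev'XE -compA -act21_comp twist_nat act21_comp22 compA.
rewrite (rw2 _ (under21 _ _ _)) !compA ev_mate (rw2 _ (esym (braid_mate _ _ _))).
rewrite !compA (rw2 _ (esym (lwM _ _ _))) -braid_mate; move: (mate r X) => m.
by rewrite !lwM !compA (rw2 _ (esym (act22_nat _ _))) !compA ev'X_nested.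
Qed.

(** Cyclicity: [r] travels round the loop until it meets [i]. The loop on [J] becomes nested loops
    on [V] and [Y], and the inner one closes [i ∘ r]. *)
Lemma trR_cyc A J V Y (h : endo (A ⊗ V)) (r : hom (V ⊗ Y) J)
    (i : hom J (V ⊗ Y)) :
  trR ((A ◁ r) ∘ act22 h Y ∘ (A ◁ i) : endo (A ⊗ J))
  = trR (h ∘ (A ◁ trR (i ∘ r : endo (V ⊗ Y))) : endo (A ⊗ V)).
Proof.
apply: rwhisker_unit_inj; move: 𝟙 => X.
have act_conj Z : act22 ((A ◁ r) ∘ act22 h Y ∘ (A ◁ i)) Z
    = (A ◁ act21 r Z) ∘ act22 h (Y ⊗ Z) ∘ (A ◁ act12 i Z).
  rewrite !act22_comp !act22_lw act22_act22.
  by rewrite act21.unlock act12.unlock !lwM !compA.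
have cap : (A ◁ ev'X J X) ∘ (A ◁ act21 r (J^⋆ ⊗ X))
    = (A ◁ ev'X V X) ∘ (A ◁ V ◁ ev'X Y (V^⋆ ⊗ X)) ∘ (A ◁ V ◁ Y ◁ mate r X).
  by rewrite -!lwM ev'X_slide.
have cup : (A ◁ V ◁ Y ◁ mate r X) ∘ (A ◁ act12 i (J^⋆ ⊗ X)) ∘ (A ◁ coevX J X)
    = (A ◁ act22 (i ∘ r) (Y^⋆ ⊗ (V^⋆ ⊗ X))) ∘ (A ◁ V ◁ coevX Y (V^⋆ ⊗ X))
      ∘ (A ◁ coevX V X).
  by rewrite -!lwM -act12_nat -[act12 i _ ∘ _ ∘ _]compA mate_coev act22_comp12 !compA.
rewrite trRE act_conj !compA cap (rw2 _ (esym (act22_nat _ _))) !compA (rw3 _ cup).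
rewrite trRE act22_comp act22_lw trRE !lwM !compA.
by rewrite [in RHS](rw2 _ (act22_nat _ _)) !compA.
Qed.

Lemma modified_trace_swap J V W Y (a : hom V (J ⊗ W)) (b : hom (J ⊗ W) V)
    (i : hom J (V ⊗ Y)) (r : hom (V ⊗ Y) J) :
  exists f : endo (J ⊗ J),
    trL f = r ∘ ((b ∘ a) ▷ Y) ∘ i /\
    trR f = trR (a ∘ trR (i ∘ r : endo (V ⊗ Y)) ∘ b : endo (J ⊗ W)).
Proof.
(* A kink-free crossing placed between [a] and [b], so that the left trace of [h] is [b ∘ a]. *)
pose h : endo (J ⊗ V) := (J ◁ b) ∘ act22 (twisted_braid J) W ∘ (J ◁ a).
exists ((J ◁ r) ∘ act22 h Y ∘ (J ◁ i)); split.
  rewrite trL_slide; congr (_ ∘ (_ ▷ _) ∘ _).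
  by rewrite trL_slide trL_twisted_braid tensm1 compm1.
rewrite trR_cyc.
have -> : h ∘ (J ◁ trR (i ∘ r : endo (V ⊗ Y)))
    = (J ◁ b) ∘ act22 (twisted_braid J) W ∘ (J ◁ (a ∘ trR (i ∘ r : endo (V ⊗ Y)))).
  by rewrite /h lwM !compA.
rewrite trR_cyc; set t := trR (_ ∘ b).
(* The crossing carries [t] from the closed strand to the open one, where it leaves the trace. *)
have -> : twisted_braid J ∘ (J ◁ t) = (t ▷ J) ∘ twisted_braid J.
  by rewrite /twisted_braid !compA -braid_nat -!compA interchange.
by rewrite trR_comp trR_twisted_braid compm1.
Qed.

End Traces.

(** * Scalars, composition and tensor products *)

Section Scalars.
Variable C : tensorAbCat.
Implicit Types X Y : C.

Lemma scalemEr X Y (k : ground C) (f : hom X Y) :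
  scalem k f = f ∘ scalem k (Id X).
Proof.
rewrite /scalem !compA -lunit_nat (rw2 _ (interchange _ _)).
by rewrite -tensmM compm1 comp1m.
Qed.

Lemma scalem_tens X Y (k : ground C) :
  scalem k (Id (X ⊗ Y)) = scalem k (Id X) ▷ Y.
Proof.
rewrite /scalem !rwM -lunit_tens (rw2 _ (assoc_natl _ _ _)) !compA.
by rewrite (rw2 _ (lunitV_tens _ _)).
Qed.

End Scalars.

(** * Projectives and ideals *)

Section Adjunction.
Variable C : ribbonAbCat.
Implicit Types P X Y Z : C.

Lemma runit_tens X Y : (X ◁ ρ Y) ∘ α X Y 𝟙 = ρ (X ⊗ Y).
Proof.
apply: rwhisker_unit_inj; rewrite rwM.
apply: (split_mono (assocK X Y 𝟙)); rewrite !compA assoc_nat.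
rewrite -triangle lwM (rw3 _ (esym (pentagon _ _ _ _))) !compA.
by rewrite -assoc_nat tensm1 -compA triangle.
Qed.

(** Transposition for the adjunction between [- ⊗ Z] and [- ⊗ Z^⋆]. *)
Definition curry X Z Y (f : hom (X ⊗ Z) Y) : hom X (Y ⊗ Z^⋆) :=
  (f ▷ Z^⋆) ∘ α⁻¹ X Z Z^⋆ ∘ (X ◁ coev Z) ∘ ρ⁻¹ X.

Definition uncurry X Z Y (g : hom X (Y ⊗ Z^⋆)) : hom (X ⊗ Z) Y :=
  ρ Y ∘ (Y ◁ ev Z) ∘ α Y Z^⋆ Z ∘ (g ▷ Z).

Lemma curryK X Z Y (f : hom (X ⊗ Z) Y) : uncurry (curry f) = f.
Proof.
have -> : curry f = (f ▷ Z^⋆) ∘ (α⁻¹ X Z Z^⋆ ∘ (X ◁ coev Z) ∘ ρ⁻¹ X).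
  by rewrite /curry !compA.
rewrite /uncurry rwM lw_cup_rw !compA (rw2 _ (assoc_natl _ _ _)) !compA.
rewrite (splitK _ (assocVK _ _ _)) (rw2 _ (interchange _ _)) !compA runit_nat.
rewrite -tensm1 (rw2 _ (esym (assocV_nat _ _ _))) -runit_tens !compA.
rewrite (splitK _ (assocVK _ _ _)) -!compA -!lwM.
have -> : ρ Z ∘ ((Z ◁ ev Z) ∘ act02 (coev Z) Z) = Id Z.
  by rewrite -[RHS]zigzag1 act02.unlock !compA.
by rewrite tensm1 compm1.
Qed.

Lemma curry_nat X X' Z Y (f : hom (X ⊗ Z) Y) (e : hom X' X) :
  curry (f ∘ (e ▷ Z)) = curry f ∘ e.
Proof.
rewrite /curry (rw2 _ (runitV_nat _)) !compA (rw2 _ (interchange _ _)) !compA.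
by rewrite -[Id (Z ⊗ Z^⋆)]tensm1 (rw2 _ (assocV_nat _ _ _)) rwM !compA.
Qed.

(** A left adjoint preserves epimorphisms. *)
Lemma epi_tens X Y Z (e : hom X Y) : is_epi e -> is_epi (e ▷ Z).
Proof.
move=> epi_e T g h eq_gh; rewrite -[g]curryK -[h]curryK; congr uncurry.
by apply: epi_e; rewrite -!curry_nat eq_gh.
Qed.

(** The right adjoint [- ⊗ Z^⋆] preserves epimorphisms, so the transpose of [f] lifts and its lift
    transposes back. *)
Lemma projective_tens P Z : projective P -> projective (P ⊗ Z).
Proof.
move=> projP X Y e f /(@epi_tens _ _ Z^⋆) /projP - /(_ (curry f)) [g eg].
exists (uncurry g); rewrite -[RHS]curryK -eg /uncurry rwM !compA.
by rewrite (rw2 _ (assoc_natl _ _ _)) !compA (rw2 _ (interchange _ _)) !compA runit_nat.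
Qed.

Lemma projective_retract P Q (i : hom Q P) (r : hom P Q) :
  r ∘ i = Id Q -> projective P -> projective Q.
Proof.
move=> ri projP X Y e f epi_e; have [g eg] := projP _ _ e (f ∘ r) epi_e.
by exists (g ∘ i); rewrite compA eg -compA ri compm1.
Qed.

End Adjunction.

Section Ideals.
Variable C : ribbonAbCat.
Implicit Types J U V W X Y : C.

Lemma in_ideal_trans J V U : in_ideal J V -> in_ideal V U -> in_ideal J U.
Proof.
move=> [W [a [b ba]]] [W' [a' [b' ba']]].
exists (W ⊗ W'), (α J W W' ∘ (a ▷ W') ∘ a'), (b' ∘ (b ▷ W') ∘ α⁻¹ J W W').
rewrite !compA (splitK _ (assocK _ _ _)).
by rewrite (rw2 _ (rw_can _ ba)) compm1.
Qed.

(** Braiding [V^⋆] past [V] turns the source of the evaluation into [V ⊗ (V^⋆ ⊗ X)]. *)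
Lemma splits_in_ideal V X :
  splits (λ X ∘ (ev V ▷ X)) -> in_ideal V X.
Proof.
move=> [s es].
exists (V^⋆ ⊗ X), (α V V^⋆ X ∘ (braid V^⋆ V ▷ X) ∘ s).
exists (λ X ∘ (ev V ▷ X) ∘ (braidV V^⋆ V ▷ X) ∘ α⁻¹ V V^⋆ X).
rewrite !compA (splitK _ (assocK _ _ _)).
by rewrite (splitK _ (rw_can _ (braidK _ _))).
Qed.

(* [V] is a retract of [V^⋆ ⊗ V ⊗ V] along the evaluation: braid the last
   strand to the front and bend it with the coevaluation. *)
Lemma in_ideal_splits V X :
  in_ideal V X -> splits (λ X ∘ (ev V ▷ X)).
Proof.
move=> [Y [i [r ri]]].
have -> : λ X ∘ (ev V ▷ X) = evX V X ∘ α V^⋆ V X.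
  by rewrite act20.unlock (splitK _ (assocK _ _ _)).
exists (α⁻¹ V^⋆ V X ∘ (V^⋆ ◁ V ◁ r) ∘ (V^⋆ ◁ braidX V V Y)
  ∘ braidX V V^⋆ (V ⊗ Y) ∘ coevX V (V ⊗ Y) ∘ i).
rewrite !compA (splitK _ (assocVK _ _ _)) act20_nat.
by rewrite (rw3 _ (esym (over20 _ _ _))) (splitK _ (act_zigzag _ _)).
Qed.

Lemma residue_invertible (fieldK : is_field (ground C)) J
    (p : endo J -> ground C) (f : endo J) :
    residue_map p ->
    (forall g : endo J, Rad (endo J) g -> exists n : nat, g ^+ n = 0) ->
  p f <> 0 -> exists g : endo J, f ∘ g = Id J.
Proof.
move=> [p_lin [p1 pM] _ p_rad] nil pf0; have [_ _ inv] := fieldK.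
have [y [ypf _]] := inv _ pf0.
have p0 : p 0 = 0 by have := p_lin (-1) 0 0; rewrite scaler0 addr0 mulN1r addNr.
have pZ k u : p (k *: u) = k * p u by rewrite -[k *: u]addr0 p_lin p0 addr0.
have [n nil_n] : exists n, (1 - y *: f) ^+ n = 0.
  by apply: nil; apply/p_rad; rewrite addrC -scaleN1r p_lin pZ ypf p1 mulr1 addNr.
(* The geometric sum [s] inverts [y *: f], since [1 - y *: f] is nilpotent. *)
have := subrX1 (1 - y *: f) n; set s := \sum_(i < n) _.
rewrite nil_n sub0r addrAC subrr add0r mulNr => /oppr_inj yfs.
exists (scalem y (Id J) ∘ s).
by rewrite compA -scalemEr; exact: esym yfs.
Qed.

Lemma trR_neq0_in_ideal (fieldK : is_field (ground C)) J
    (p : endo J -> ground C) U W (a : hom U (J ⊗ W)) (b : hom (J ⊗ W) U) :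
    residue_map p ->
    (forall g : endo J, Rad (endo J) g -> exists n : nat, g ^+ n = 0) ->
  p (trR (a ∘ b : endo (J ⊗ W))) <> 0 -> in_ideal U J.
Proof.
move=> resp nil /(residue_invertible fieldK resp nil) [g tr_g].
(* The trace is cut open between [b] and [a]; the right inverse [g] corrects the section. *)
exists W^⋆, ((b ▷ W^⋆) ∘ α⁻¹ J W W^⋆ ∘ (J ◁ coev W) ∘ ρ⁻¹ J ∘ g).
exists (ρ J ∘ (J ◁ ev' W) ∘ α J W W^⋆ ∘ (a ▷ W^⋆)).
by rewrite -[RHS]tr_g /trR rwM !compA.
Qed.

(** On the [f] of [modified_trace_swap] the left trace gives [p 1 = 1], while the right one gives a
    multiple of [p (trR (a ∘ b))], as [trR (i ∘ r)] is a scalar. *)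
Lemma in_ideal_trR_neq0 (fieldK : is_field (ground C)) J
    (p : endo J -> ground C) V W (a : hom V (J ⊗ W)) (b : hom (J ⊗ W) V) :
    residue_map p -> ambidextrous_trace p ->
    (forall g : endo V, exists k : ground C, g = k *: (1 : endo V)) ->
    b ∘ a = Id V ->
  in_ideal V J -> p (trR (a ∘ b : endo (J ⊗ W))) <> 0.
Proof.
move=> [_ [p1 pM] _ _] [_ p_ambi] endV ba [Y [i [r ri]]] p_ab.
have [f [trLf trRf]] := modified_trace_swap a b i r.
have := p_ambi f; rewrite {}trLf {}trRf ba tensm1 compm1 ri.
have [k ->] := endV (trR (i ∘ r : endo (V ⊗ Y))).
(* The scalar moves past [a] onto the factor [J], so that [trR_comp] can extract it. *)
have -> : a ∘ (k *: (1 : endo V)) ∘ b = (scalem k (Id J) ▷ W) ∘ (a ∘ b).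
  by rewrite -scalem_tens -[a ∘ _]scalemEr scalemE !compA.
have [K1 _ _] := fieldK.
by rewrite trR_comp [p (_ ∘ _)]pM p_ab mulr0 p1.
Qed.

Lemma mdimE J (hJ : ambidextrous J) V (hV : in_ideal J V) :
  exists W (a : hom V (J ⊗ W)) (b : hom (J ⊗ W) V), b ∘ a = Id V /\
    mdim hJ hV = bracket (ambi_indec hJ) (trR (a ∘ b : endo (J ⊗ W))).
Proof.
rewrite /mdim; case: cid => W hW; case: cid => a ha; case: cid => b ba.
by exists W, a, b.
Qed.

End Ideals.

Theorem theorem1p4p1 (C : ribbonAbCat)
    (abC : abelian_category C)
    (fieldK : is_field (ground C))
    (rad_nil : forall (X : C), absolutely_indecomposable X ->
       forall f : endo X, Rad (endo X) f -> exists n : nat, f ^+ n = 0)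
    (J : C) (hJ : ambidextrous J)
    (V : C) (hV : in_ideal J V)
    (endV : bijective (fun k : ground C => k *: (1 : endo V)))
    (epi_evV : is_epi (ev V)) :
  [/\ (* (1) *)
      forall U : C, in_ideal V U ->
        exists hU : in_ideal J U, mdim hJ hV = 0 -> mdim hJ hU = 0,
      (* (2) *)
      is_epi (lunit J ∘ (ev V ⊗ᵐ Id J)) /\
      (splits (lunit J ∘ (ev V ⊗ᵐ Id J)) <-> mdim hJ hV <> 0)
    & (* (3) *)
      ~ projective J -> forall P : C, projective P ->
        exists hP : in_ideal J P, mdim hJ hP = 0].
Proof.
have resp : residue_map (bracket (ambi_indec hJ)) by apply: (svalP (cid _)).
have nilJ := rad_nil _ (ambi_indec hJ).
have endV' (g : endo V) : exists k : ground C, g = k *: (1 : endo V).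
  by have [h _ hK] := endV; exists (h g); rewrite hK.
have mdim_in_ideal U (hU : in_ideal J U) : mdim hJ hU <> 0 -> in_ideal U J.
  have [W [a [b [_ ->]]]] := mdimE hJ hU.
  by move=> d_neq0; exact: (trR_neq0_in_ideal fieldK resp nilJ d_neq0).
have mdimV_neq0 : in_ideal V J -> mdim hJ hV <> 0.
  have [W [a [b [ba ->]]]] := mdimE hJ hV.
  by move=> hVJ; exact: (in_ideal_trR_neq0 fieldK resp (ambi_trace hJ) endV' ba hVJ).
have epi_ev X : is_epi (λ X ∘ (ev V ▷ X)).
  move=> Z g h; rewrite !compA => /(epi_tens epi_evV).
  exact: split_epi (lunitVK X).
split.
(* If the dimension of [U] were non-zero, [J] would lie in the ideal of [U], hence in that of
   [V]. *)
- move=> U hVU; exists (in_ideal_trans hV hVU) => mdimV0; apply: contrapT.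
  by move=> /mdim_in_ideal /(in_ideal_trans hVU) /mdimV_neq0.
- split=> //; split=> [/splits_in_ideal //|/mdim_in_ideal].
  exact: in_ideal_splits.
- move=> nprojJ P projP.
  (* The epimorphism from [V^⋆ ⊗ V ⊗ P] onto the projective [P] splits. *)
  have hVP : in_ideal V P.
    by apply: splits_in_ideal; apply: (projP _ _ _ (Id P)); apply: epi_ev.
  (* A non-zero dimension would make [J] a retract of the projective [P ⊗ Y]. *)
  exists (in_ideal_trans hV hVP); apply: contrapT => /mdim_in_ideal.
  move=> [Y [i [r ri]]]; apply: nprojJ.
  exact: projective_retract ri (projective_tens projP).
Qed.
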